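(* Let $Z$ be a complex space with Kobayashi pseudo-distance $d_Z$. Let $(\Omega,\mu)$ be a probability space, $T:\Omega\to\Omega$ an ergodic measure-preserving map, and $\varphi$ a map from $\Omega$ to holomorphic self-maps of $Z$ such that the cocycle $u(n,\omega)=\varphi(\omega)\varphi(T\omega)\cdots\varphi(T^{n-1}\omega)$ satisfies: for every $z\in Z$ and $n$ the map $\omega\mapsto u(n,\omega)z$ is measurable, and $\int_\Omega d_Z(z,\varphi(\omega)z)\,d\mu<\infty$ for some (equivalently all) $z$. Then for a.e. $\omega$ there is a metric functional $h^\omega$ of the pseudo-metric space $(Z,d_Z)$ such that for all $z\in Z$ $$\lim_{n\to\infty}-\frac1n h^\omega(u(n,\omega)z)=\tau:=\lim_{n\to\infty}\frac1n d_Z(u(n,\omega)z,z).$$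
   Context: Fix a base point $z_0\in Z$; for $z\in Z$ let $h_z(\cdot)=d_Z(\cdot,z)-d_Z(z_0,z)$. Endow $\mathbb{R}^Z$ with the topology of pointwise convergence. A metric functional of $(Z,d_Z)$ is an element of the closure of $\{h_z:z\in Z\}$ in $\mathbb{R}^Z$. Holomorphic maps are 1-Lipschitz for the Kobayashi pseudo-distance. *)

(* Defs.v *)
From HB Require Import structures.
From mathcomp Require Import all_boot all_order all_algebra.
From mathcomp Require Import all_classical all_reals all_analysis.
Set Implicit Arguments. Unset Strict Implicit. Unset Printing Implicit Defensive.
Import Order.TTheory GRing.Theory Num.Theory.
Import numFieldNormedType.Exports.
Local Open Scope classical_set_scope.
Local Open Scope ring_scope.

Definition is_pseudodist (R : realType) (Z : Type) (d : Z -> Z -> R) : Prop :=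
  (forall x, d x x = 0) /\ (forall x y, d x y = d y x) /\
  (forall x y w, d x w <= d x y + d y w).

Definition one_lipschitz (R : realType) (Z : Type) (d : Z -> Z -> R)
  (f : Z -> Z) : Prop := forall x y, d (f x) (f y) <= d x y.

Definition horofun (R : realType) (Z : Type) (d : Z -> Z -> R) (z0 z : Z) :
  {ptws Z -> R} := fun x => d x z - d z0 z.

Definition metric_functional (R : realType) (Z : Type) (d : Z -> Z -> R)
  (z0 : Z) (h : Z -> R) : Prop :=
  closure (range (horofun d z0)) (h : {ptws Z -> R}).

Definition measure_preserving d (Om : measurableType d) (R : realType)
  (P : probability Om R) (T : Om -> Om) : Prop :=
  measurable_fun setT T /\
  forall A, measurable A -> P (T @^-1` A) = P A.

Definition ergodic d (Om : measurableType d) (R : realType)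
  (P : probability Om R) (T : Om -> Om) : Prop :=
  forall A, measurable A -> T @^-1` A = A -> P A = 0%E \/ P A = 1%E.

Fixpoint cocycle (Om Z : Type) (T : Om -> Om) (phi : Om -> Z -> Z)
  (n : nat) (w : Om) : Z -> Z :=
  match n with
  | 0 => id
  | n'.+1 => fun z => cocycle T phi n' w (phi (iter n' T w) z)
  end.

(* Main.v *)
Require Import Defs.
From HB Require Import structures.
From mathcomp Require Import all_boot all_order all_algebra.
From mathcomp Require Import all_classical all_reals all_analysis.
From mathcomp Require Import measurable_realfun zify ring lra.
Import Order.TTheory GRing.Theory Num.Theory.
Import numFieldNormedType.Exports.
Local Open Scope classical_set_scope.
Local Open Scope ring_scope.

(* Put a n w = d(z0, u(n,w) z0), a nonnegative integrable subadditive cocycle of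
   rate tau. The key point (Gouezel and Karlsson) is that for almost every w there
   are infinitely many times n such that a(n,w) - a(n-l, T^l w) >= (tau - o(1)) l
   for all l <= n, with an o(1) that does not depend on n. Any pointwise cluster
   point h of the horofunctions of u(n,w) z0 along these n then satisfies
   h(u(l,w) z0) <= -(tau - o(1)) l, while h(u(l,w) z0) >= -a(l,w) because h is
   1-Lipschitz and h(z0) = 0.

   The good times are obtained by counting. A greedy covering of orbit segments
   and ergodicity give a(n,x) <= n (tau + e) + S_n g(x) + C for all n and x, with
   g >= 0 of integral at most e. On a segment of length N, the times m from which
   the remaining cost a(N-m, T^m w) drops too slowly are covered by disjoint long
   windows; the pointwise bound on the gaps between the windows, together with
   E a(N) >= N tau, shows that these windows have small expected total length. As
   T preserves the measure, the law of T^m w is that of w, so bad times are rare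
   on average. The same pointwise bound and the maximal inequality give
   limsup a(n,w)/n <= tau, and the good times themselves give the liminf. *)

Set Implicit Arguments.
Unset Strict Implicit.

(** * Counting arguments along a single orbit segment, without measure *)

Section OrbitSegments.
Variables (R : realType) (Om : Type) (T : Om -> Om).
Implicit Types (g : Om -> R) (x : Om).

Definition birkhoff_sum g (n : nat) x : R := \sum_(0 <= i < n) g (iter i T x).

Lemma birkhoff_sum0 g x : birkhoff_sum g 0 x = 0.
Proof. by rewrite /birkhoff_sum big_geq. Qed.

Lemma birkhoff_sumS g n x :
  birkhoff_sum g n.+1 x = birkhoff_sum g n x + g (iter n T x).
Proof. by rewrite /birkhoff_sum big_nat_recr. Qed.

Lemma birkhoff_sumD g m n x :
  birkhoff_sum g (m + n) x = birkhoff_sum g m x + birkhoff_sum g n (iter m T x).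
Proof.
elim: n => [|n IH]; first by rewrite addn0 birkhoff_sum0 addr0.
by rewrite addnS !birkhoff_sumS IH -addrA -iterD addnC.
Qed.

Lemma birkhoff_sum_ge0 g n x : (forall y, 0 <= g y) -> 0 <= birkhoff_sum g n x.
Proof. by move=> g0; apply: sumr_ge0 => i _. Qed.

(** Each jump moves strictly forward and stays within [n], so a chain of jumps from [0] ends at [n].
    Greedy coverings by windows of varying length reduce to exhibiting one jump. *)
Lemma le_by_jumps (V : nat -> R) (n : nat) :
  (forall m, (m < n)%N -> exists m', [/\ (m < m')%N, (m' <= n)%N & V m <= V m']) ->
  V 0%N <= V n.
Proof.
move=> jump.
suff H k : forall m, (n - m <= k)%N -> (m <= n)%N -> V m <= V n.
  exact: (H n 0%N (leq_subr _ _) (leq0n _)).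
elim: k => [|k IH] m km mn.
  by have -> : m = n by lia.
have [lt_mn|?] := ltnP m n; last by have -> : m = n by lia.
have [m' [mm' m'n Vm]] := jump m lt_mn.
by apply: le_trans Vm _; apply: IH => //; lia.
Qed.

Section Maximal.
Variables (g : Om -> R) (g_ge0 : forall x, 0 <= g x) (eta : R) (M : nat).

(** The cap [M] on the window length bounds how far a window can overrun the end of a segment. *)
Definition exceeds : set Om :=
  [set x | exists n, [/\ (0 < n)%N, (n <= M)%N & n%:R * eta <= birkhoff_sum g n x]].

(** A visit opens a window of average at least [eta], which pays for all visits inside it, as these
    are at most its length. A window opened before time [n - M] ends by time [n]. *)
Lemma exceeds_count n x : 0 <= eta ->
  eta * birkhoff_sum \1_exceeds (n - M) x <= birkhoff_sum g n x.
Proof.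
move=> eta0.
have i0 y : 0 <= \1_exceeds y :> R by rewrite indicE.
have i1 y : \1_exceeds y <= 1 :> R by rewrite indicE; case: (y \in _).
have ci l : forall y, birkhoff_sum \1_exceeds l y <= l%:R.
  elim: l => [|l IH] y; first by rewrite birkhoff_sum0.
  by rewrite birkhoff_sumS -natr1 lerD.
(* [minn] freezes the count at time [n - M], which the last window may cross. *)
pose V m := birkhoff_sum g m x - eta * birkhoff_sum \1_exceeds (minn m (n - M)) x.
suff : V 0%N <= V n.
  rewrite /V min0n !birkhoff_sum0 mulr0 subrr subr_ge0.
  by have /minn_idPr -> : (n - M <= n)%N by lia.
apply: le_by_jumps => m mn; have [mM|mM] := ltnP m (n - M); last first.
  exists m.+1; split => //; rewrite /V.
  have -> : minn m (n - M) = (n - M)%N by lia.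
  have -> : minn m.+1 (n - M) = (n - M)%N by lia.
  by rewrite birkhoff_sumS; have := g_ge0 (iter m T x); lra.
have -> : V m = birkhoff_sum g m x - eta * birkhoff_sum \1_exceeds m x.
  by rewrite /V (minn_idPl (ltnW mM)).
have [[l [l0 lM gl]]|nex] := pselect (exceeds (iter m T x)); last first.
  exists m.+1; split => //; rewrite /V (minn_idPl mM) !birkhoff_sumS.
  rewrite indicE memNset// addr0.
  by have := g_ge0 (iter m T x); lra.
exists (m + l)%N; split; [lia|lia|rewrite /V].
have [l' -> l'l] : exists2 l', minn (m + l) (n - M) = (m + l')%N & (l' <= l)%N.
  by exists (minn (m + l) (n - M) - m)%N; lia.
rewrite !birkhoff_sumD mulrDr.
have : eta * birkhoff_sum \1_exceeds l' (iter m T x) <= l%:R * eta.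
  rewrite [leRHS]mulrC ler_wpM2l//; apply: le_trans (ci _ _) _.
  by rewrite ler_nat.
lra.
Qed.

End Maximal.

Section Subadditive.
Variable a : nat -> Om -> R.
Hypothesis a0 : forall x, a 0 x = 0.
Hypothesis a_sub : forall m n x, a (m + n) x <= a m x + a n (iter m T x).

(* Cut the orbit segment greedily into stretches of length at most [N] of
   average cost at most [c], charging [g] at the times in [B]; the last [N] steps
   may overshoot [n] and are taken one at a time. *)
Lemma subadditive_cover (c : R) (N : nat) (B : set Om) (g : Om -> R) :
  0 <= c -> (forall x, 0 <= g x) ->
  (forall x, ~ B x -> exists l, [/\ (0 < l)%N, (l <= N)%N & a l x <= l%:R * c]) ->
  (forall x, B x -> a 1 x <= g x) ->
  (forall x, a 1 x <= N%:R + g x) ->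
  forall n x, a n x <= n%:R * c + birkhoff_sum g n x + N%:R * N%:R.
Proof.
move=> c0 g0 good bad single n x.
(* [V m] is the remaining cost plus what the first [m] steps have been charged. By truncated
   subtraction the last term is zero up to [n - N], then grows by [N] per step, to at most
   [N * N]. *)
pose V m := a (n - m) (iter m T x) + m%:R * c + birkhoff_sum g m x
  + (m - (n - N))%:R * N%:R.
have N0 : 0 <= N%:R :> R by [].
suff : V 0%N <= V n.
  rewrite /V subn0 sub0n !mul0r birkhoff_sum0 !addr0 subnn a0 add0r /= => /le_trans.
  by apply; rewrite lerD2l ler_wpM2r// ler_nat; lia.
have step m l : (m + l <= n)%N ->
    a (n - m) (iter m T x) <= a l (iter m T x) + a (n - (m + l)) (iter (m + l) T x).
  move=> mln; have -> : (n - m = l + (n - (m + l)))%N by lia.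
  by rewrite [X in _ + a _ X](_ : _ = iter l T (iter m T x)) // -iterD addnC.
apply: le_by_jumps => m mn; rewrite /V.
have st1 : a (n - m) (iter m T x) <=
    a 1 (iter m T x) + a (n - m.+1) (iter m.+1 T x).
  by have := @step m 1%N; rewrite addn1; apply.
have [mN|mN] := leqP (m + N) n; last first.
  exists m.+1; split => //.
  have -> : (m.+1 - (n - N) = (m - (n - N)).+1)%N by lia.
  rewrite birkhoff_sumS -!natr1.
  by have := single (iter m T x); lra.
have tr k : (m - (n - N))%:R * N%:R <= ((m + k) - (n - N))%:R * N%:R :> R.
  by rewrite ler_wpM2r// ler_nat; lia.
have [Bm|nBm] := pselect (B (iter m T x)).
  exists m.+1; split => //; rewrite birkhoff_sumS -[m.+1%:R]natr1.
  by have := tr 1%N; rewrite addn1; have := bad _ Bm; lra.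
have [l [l0 lN al]] := good _ nBm.
exists (m + l)%N; split; [lia|lia|].
rewrite birkhoff_sumD natrD.
have := tr l; have := @step m l; have := birkhoff_sum_ge0 l (iter m T x) g0.
by move=> h1 /(_ ltac:(lia)); lra.
Qed.

(** The failure of the good-time property at horizon [n], for rate [b] and stretches of length at
    least [L]. *)
Definition slow_drop (b : R) (L n : nat) : set Om :=
  [set x | exists l, [/\ (L <= l)%N, (l <= n)%N &
    a n x - a (n - l) (iter l T x) <= l%:R * b]].

(* Call [m] bad if [T^m x] lies in [slow_drop b L (n - m)]. A bad [m] starts a
   window of length at least [L] over which the remaining cost
   [a (n - m) (T^m x)] decreases at rate at most [b]; the gap from the end of a
   window to the next bad time is crossed at rate [c] up to the additive
   constant [C], which the length of the window compensates. *)
Lemma slow_drop_count (b c C : R) (L : nat) (g : Om -> R) n x :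
  0 <= C -> (forall y, 0 <= g y) ->
  (forall k y, a k y <= k%:R * c + birkhoff_sum g k y + C) ->
  forall eps, 0 <= eps -> (0 < L)%N -> C <= L%:R * (c - b - eps) ->
  a n x + eps * \sum_(0 <= m < n) \1_(slow_drop b L (n - m)) (iter m T x)
    <= n%:R * c + birkhoff_sum g n x + C.
Proof.
move=> C0 g0 ub eps eps0 L0 CL.
pose bad m := slow_drop b L (n - m) (iter m T x).
pose cnt m m' : R := \sum_(m <= i < m') \1_(slow_drop b L (n - i)) (iter i T x).
have cnt_le m k : cnt m (m + k)%N <= k%:R.
  elim: k => [|k IH]; first by rewrite /cnt addn0 big_geq.
  rewrite addnS /cnt big_nat_recr ?leq_addr//= -natr1.
  by apply: lerD; [exact: IH | rewrite indicE; case: (_ \in _)].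
have cnt_cat m k m' : (m + k <= m')%N -> cnt m m' = cnt m (m + k)%N + cnt (m + k)%N m'.
  by move=> ?; rewrite /cnt -big_cat_nat// leq_addr.
pose v m := a (n - m) (iter m T x).
pose F m := (n - m)%:R * c + birkhoff_sum g (n - m) (iter m T x) - eps * cnt m n.
have F_cat m k : (m + k <= n)%N -> F m = k%:R * c + birkhoff_sum g k (iter m T x)
    - eps * cnt m (m + k)%N + F (m + k)%N.
  move=> mkn; rewrite /F (cnt_cat m k)//.
  have -> : (n - m = k + (n - (m + k)))%N by lia.
  rewrite birkhoff_sumD natrD -iterD [(k + m)%N]addnC; ring.
(* Backward induction from [n]: the bound holds without [C] at bad times and at [n], and with [C]
   elsewhere. *)
suff H k : forall m, (n - m <= k)%N -> (m <= n)%N ->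
    (bad m \/ m = n -> v m <= F m) /\ v m <= F m + C.
  have [_] := H n 0%N ltac:(lia) ltac:(lia).
  by rewrite /v /F /cnt subn0 /=; lra.
elim: k => [|k IH] m km mn.
  have -> : m = n by lia.
  have : v n <= F n.
    by rewrite /v /F subnn a0 mul0r birkhoff_sum0 /cnt big_geq// mulr0 subr0 addr0.
  by split => //; lra.
have [bm|nbm] := pselect (bad m \/ m = n).
  suff vF : v m <= F m by split => //; lra.
  case: bm => [[l [Ll ln al]]|->]; last first.
    by rewrite /v /F subnn a0 mul0r birkhoff_sum0 /cnt big_geq// mulr0 subr0 addr0.
  have [_ IHl] := IH (m + l)%N ltac:(lia) ltac:(lia).
  rewrite (F_cat m l); last lia.
  have : v m - v (m + l)%N <= l%:R * b.
    by rewrite /v [(m + l)%N]addnC iterD [(l + m)%N]addnC subnDA.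
  have := birkhoff_sum_ge0 l (iter m T x) g0.
  have : eps * cnt m (m + l)%N <= l%:R * eps by rewrite [leRHS]mulrC ler_wpM2l.
  have : C <= l%:R * (c - b - eps).
    apply: le_trans (CL) _.
    have [p|p] := leP 0 (c - b - eps); first by rewrite ler_wpM2r// ler_nat.
    have : L%:R * (c - b - eps) < 0 by rewrite nmulr_llt0// ltr0n.
    by lra.
  by rewrite !mulrBr; lra.
split => [/nbm//|].
(* Move to the next bad time, or to [n]. Nothing is counted on the way, and the bound without [C]
   holds on arrival, so [C] is paid once. *)
pose Q j := `[< bad (m + j)%N >] || ((m + j)%N == n).
have exQ : exists j, Q j by exists (n - m)%N; rewrite /Q subnKC// eqxx orbT.
case: (ex_minnP exQ) => j Qj minj.
have jn : (j <= n - m)%N by apply: minj; rewrite /Q subnKC// eqxx orbT.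
have j0 : (0 < j)%N.
  case: j Qj {minj jn} => // /orP[/asboolP|/eqP]; rewrite addn0 => h; exfalso; tauto.
have vF : v (m + j)%N <= F (m + j)%N.
  have [+ _] := IH (m + j)%N ltac:(lia) ltac:(lia); apply.
  by case/orP: Qj => [/asboolP|/eqP]; [left|right].
have cnt0 : cnt m (m + j)%N = 0.
  rewrite /cnt big_nat big1// => i /andP[mi ij].
  rewrite indicE memNset// => bi.
  have : Q (i - m)%N by rewrite /Q subnKC//; apply/orP; left; apply/asboolP.
  by move/minj; lia.
rewrite (F_cat m j) ?cnt0; last lia.
have := ub j (iter m T x); have := a_sub j (n - (m + j)) (iter m T x).
rewrite -iterD [(j + m)%N]addnC.
have -> : (j + (n - (m + j)) = n - m)%N by lia.
rewrite /v in vF *; lra.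
Qed.

End Subadditive.
End OrbitSegments.

(** * Real-valued expectations and probabilities *)

Section Expectation.
Context d (Om : measurableType d) (R : realType) (P : probability Om R).
Implicit Types (f g : Om -> R) (A B : set Om).

Definition integrableR f := P.-integrable setT (EFin \o f).
Definition expect f : R := \int[P]_x f x.
Definition pr A : R := fine (P A).

Lemma integrableR_measurable f : integrableR f -> measurable_fun setT f.
Proof. by move=> /measurable_int /measurable_EFinP. Qed.

Lemma le_integrableR f g : measurable_fun setT f ->
  (forall x, 0 <= f x <= g x) -> integrableR g -> integrableR f.
Proof.
move=> mf fg; apply: le_integrable => //; first exact/measurable_EFinP.
move=> x _; have /andP[f0 fgx] := fg x.
by rewrite /= lee_fin !ger0_norm// (le_trans f0).
Qed.

Lemma integrableRD f g :
  integrableR f -> integrableR g -> integrableR (fun x => f x + g x).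
Proof. by move=> fi gi; exact: (integrableD measurableT fi gi). Qed.

Lemma integrableRZ c f : integrableR f -> integrableR (fun x => c * f x).
Proof. by move=> fi; exact: (integrableZl measurableT c fi). Qed.

Lemma integrableR_cst c : integrableR (fun=> c).
Proof. exact: finite_measure_integrable_cst. Qed.

Lemma integrableR_indic A : measurable A -> integrableR \1_A.
Proof. exact: integrable_indic. Qed.

Lemma integrableR_sum (I : Type) (s : seq I) (F : I -> Om -> R) :
  (forall i, integrableR (F i)) -> integrableR (fun x => \sum_(i <- s) F i x).
Proof.
move=> Fi; elim: s => [|i s IH].
  by under eq_fun do rewrite big_nil; exact: integrableR_cst.
by under eq_fun do rewrite big_cons; exact: integrableRD.
Qed.

Lemma expectD f g : integrableR f -> integrableR g ->
  expect (fun x => f x + g x) = expect f + expect g.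
Proof. by move=> fi gi; exact: RintegralD. Qed.

Lemma expectZ c f : integrableR f -> expect (fun x => c * f x) = c * expect f.
Proof. by move=> fi; exact: RintegralZl. Qed.

Lemma expect_cst c : expect (fun=> c) = c.
Proof.
have PT : fine (P setT) = 1 by rewrite probability_setT.
by rewrite /expect Rintegral_cst// -[RHS]mulr1; congr (_ * _); exact: PT.
Qed.

Lemma expect_sum (I : Type) (s : seq I) (F : I -> Om -> R) :
  (forall i, integrableR (F i)) ->
  expect (fun x => \sum_(i <- s) F i x) = \sum_(i <- s) expect (F i).
Proof.
move=> Fi; elim: s => [|i s IH].
  by under eq_fun do rewrite big_nil; rewrite expect_cst big_nil.
under eq_fun do rewrite big_cons.
by rewrite big_cons -IH expectD//; exact: integrableR_sum.
Qed.

Lemma expect_indic A : measurable A -> expect \1_A = pr A.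
Proof. by move=> mA; rewrite /expect /Rintegral integral_indic// setIT. Qed.

Lemma le_expect f g : integrableR f -> integrableR g ->
  (forall x, f x <= g x) -> expect f <= expect g.
Proof. by move=> fi gi fg; exact: le_Rintegral. Qed.

Lemma expect_ge0 f : (forall x, 0 <= f x) -> 0 <= expect f.
Proof. by move=> f0; exact: Rintegral_ge0. Qed.

Lemma prE A : measurable A -> P A = (pr A)%:E.
Proof. by move=> mA; rewrite /pr fineK// fin_num_measure. Qed.

Lemma pr_ge0 A : 0 <= pr A.
Proof. by rewrite /pr fine_ge0. Qed.

Lemma le_pr A B : measurable A -> measurable B -> A `<=` B -> pr A <= pr B.
Proof.
move=> mA mB AB; rewrite -lee_fin -!prE//.
by apply: le_measure => //; rewrite inE.
Qed.

Lemma pr_le1 A : measurable A -> pr A <= 1.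
Proof. by move=> mA; rewrite -lee_fin -prE// probability_le1. Qed.

Lemma pr_bigcup_cvg (F : (set Om)^nat) : (forall n, measurable (F n)) ->
  nondecreasing_seq F -> pr (F n) @[n --> \oo] --> pr (\bigcup_n F n).
Proof.
move=> mF ndF; apply: fine_cvg; rewrite -prE; last exact: bigcupT_measurable.
by apply: nondecreasing_cvg_mu => //; exact: bigcupT_measurable.
Qed.

Lemma pr_bigsetU (F : (set Om)^nat) n : (forall i, measurable (F i)) ->
  pr (\big[setU/set0]_(i < n) F i) <= \sum_(i < n) pr (F i).
Proof.
move=> mF; rewrite -lee_fin -prE; last exact: bigsetU_measurable.
rewrite -sumEFin (le_trans (Boole_inequality _ _))// lee_sum// => i _.
by rewrite -prE.
Qed.

(** The intersection of measurable supersets of probability at most [1 / (n + 1)] is a measurable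
    null superset. Thus [A] itself need not be shown measurable. *)
Lemma negligible_small A :
  (forall e : R, 0 < e -> exists B, [/\ measurable B, A `<=` B & pr B <= e]) ->
  P.-negligible A.
Proof.
move=> small.
have /choice[B hB] : forall n : nat, exists B, [/\ measurable B, A `<=` B & pr B <= n.+1%:R^-1].
  by move=> n; apply: small; rewrite invr_gt0.
have mB n : measurable (B n) by have [] := hB n.
have mI : measurable (\bigcap_n B n) by exact: bigcapT_measurable.
exists (\bigcap_n B n); split => //; last first.
  by move=> x Ax n _; have [_ + _] := hB n; exact.
rewrite prE//; congr EFin; apply/eqP; rewrite eq_le pr_ge0 andbT.
apply/ler_addgt0Pl => e e0; rewrite addr0.
have [n] := ltr_add_invr e0; rewrite add0r => /ltW ne.
apply: le_trans ne; have [_ _ Bn] := hB n; apply: le_trans Bn.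
by apply: le_pr => //; exact: bigcap_inf.
Qed.

Lemma measurable_leset f g : measurable_fun setT f -> measurable_fun setT g ->
  measurable [set x | f x <= g x].
Proof.
by move=> mf mg; have := measurable_fun_le measurableT mf mg; rewrite setTI.
Qed.

End Expectation.

(** * Invariance of expectations and the maximal inequality *)

Section MeasurePreserving.
Context d (Om : measurableType d) (R : realType) (P : probability Om R).
Variable T : Om -> Om.
Hypothesis mpT : measure_preserving P T.
Local Notation integrableR := (integrableR P).
Local Notation expect := (expect P).
Local Notation pr := (pr P).

Lemma measurable_iter n : measurable_fun setT (iter n T).
Proof.
elim: n => [|n IH]; first exact: measurable_id.
by apply: measurableT_comp IH; case: mpT.
Qed.

Lemma pr_preimage_iter n A : measurable A -> pr (iter n T @^-1` A) = pr A.
Proof.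
move=> mA; elim: n => [//|n <-]; rewrite /pr.
have -> : iter n.+1 T @^-1` A = T @^-1` (iter n T @^-1` A).
  by apply/seteqP; split=> x /=; rewrite -iterS iterSr.
have [_ ->//] := mpT.
by rewrite -[_ @^-1` _]setTI; exact: measurable_iter.
Qed.

Lemma integral_measure_preserving (f : Om -> \bar R) : measurable_fun setT f ->
  (forall x, 0 <= f x)%E -> (\int[P]_x f (T x) = \int[P]_x f x)%E.
Proof.
move=> mf f0; have [mT PT] := mpT.
have := @ge0_integral_pushforward _ _ _ _ _ _ mT P _ f measurableT mf.
rewrite preimage_setT => /(_ (fun x _ => f0 x)) <-.
by apply: eq_measure_integral => A mA _; exact: PT.
Qed.

Lemma integrableR_iter n (f : Om -> R) : integrableR f -> (forall x, 0 <= f x) ->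
  integrableR (fun x => f (iter n T x)).
Proof.
move=> fi f0; elim: n => [//|n IH].
have m1 : measurable_fun setT (fun x => f (iter n T x)).
  exact: (integrableR_measurable IH).
have mT : measurable_fun setT T by case: mpT.
under eq_fun do rewrite iterSr.
apply/integrableP; split.
  exact/measurable_EFinP/(measurableT_comp m1 mT).
have /integrableP[_] := IH; apply: le_lt_trans.
have ma : measurable_fun setT (fun x => `|(f (iter n T x))%:E|)%E.
  by apply: measurableT_comp => //; exact/measurable_EFinP.
by rewrite (@integral_measure_preserving (fun x => `|(f (iter n T x))%:E|)%E).
Qed.

Lemma expect_iter n (f : Om -> R) : integrableR f -> (forall x, 0 <= f x) ->
  expect (fun x => f (iter n T x)) = expect f.
Proof.
move=> fi f0; elim: n => [//|n <-].
have m1 : measurable_fun setT (fun x => f (iter n T x)).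
  exact: integrableR_measurable (integrableR_iter n fi f0).
under eq_fun do rewrite iterSr.
rewrite /expect /Rintegral.
rewrite (@integral_measure_preserving (fun x => (f (iter n T x))%:E))//.
  exact/measurable_EFinP.
by move=> x; rewrite lee_fin.
Qed.

Lemma integrableR_birkhoff n (f : Om -> R) : integrableR f -> (forall x, 0 <= f x) ->
  integrableR (birkhoff_sum T f n).
Proof. by move=> fi f0; apply: integrableR_sum => i; exact: integrableR_iter. Qed.

Lemma expect_birkhoff n (f : Om -> R) : integrableR f -> (forall x, 0 <= f x) ->
  expect (birkhoff_sum T f n) = n%:R * expect f.
Proof.
move=> fi f0; rewrite /birkhoff_sum expect_sum; last by move=> i; exact: integrableR_iter.
under eq_bigr do rewrite expect_iter//.
by rewrite big_const_nat subn0 iter_addr_0 mulr_natl.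
Qed.

(** Integrating [exceeds_count] over [N] steps bounds [eta * pr (F M)] by [expect f] up to a term of
    order [M / N]. Let [N], then [M], tend to infinity. *)
Lemma maximal_inequality (f : Om -> R) (eta : R) :
  integrableR f -> (forall x, 0 <= f x) -> 0 < eta ->
  exists B, [/\ measurable B, pr B <= expect f / eta &
    forall n x, ~ B x -> birkhoff_sum T f n x <= n%:R * eta].
Proof.
move=> fi f0 eta0.
have mS n : measurable_fun setT (birkhoff_sum T f n).
  exact: integrableR_measurable (integrableR_birkhoff n fi f0).
pose G n := [set x | n.+1%:R * eta <= birkhoff_sum T f n.+1 x].
have mG n : measurable (G n) by apply: measurable_leset.
pose F M := exceeds T f eta M.
have FE M : F M = \big[setU/set0]_(n < M) G n.
  rewrite -bigcup_mkord; apply/seteqP; split=> x.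
    by case=> -[|n] [n0 nM h] //; exists n.
  by move=> [n /= nM h]; exists n.+1.
have mF M : measurable (F M) by rewrite FE; exact: bigsetU_measurable.
have ndF : nondecreasing_seq F.
  by move=> m n mn; rewrite !FE; apply/subsetPset; exact: subset_bigsetU.
exists (\bigcup_M F M); split; first exact: bigcupT_measurable.
- rewrite ler_pdivlMr// mulrC.
  have cv : eta * pr (F M) @[M --> \oo] --> eta * pr (\bigcup_M F M).
    by apply: cvgMr; exact: pr_bigcup_cvg.
  rewrite -(cvg_lim _ cv)//; apply: limr_le; first by apply/cvg_ex; eexists; exact: cv.
  apply: nearW => M.
  apply/ler_addgt0Pl => e e0.
  (* With this [N] the [M] starting times left uncounted cost at most [N * e]. *)
  pose N := (Num.truncn (M%:R * (eta * pr (F M)) / e)).+1.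
  have /ltW := truncnS_gt (M%:R * (eta * pr (F M)) / e); rewrite -/N ler_pdivrMr// => Ne.
  have N0 : 0 < N%:R :> R by [].
  rewrite -(ler_pM2l N0) mulrDr.
  have iI : integrableR \1_(F M) by exact: integrableR_indic.
  have i0 y : 0 <= \1_(F M) y :> R by rewrite indicE.
  have : eta * expect (birkhoff_sum T \1_(F M) (N - M)) <= expect (birkhoff_sum T f N).
    rewrite -expectZ; last exact: integrableR_birkhoff.
    apply: le_expect; [|exact: integrableR_birkhoff|].
      by apply: integrableRZ; exact: integrableR_birkhoff.
    by move=> x; apply: exceeds_count => //; exact: ltW.
  rewrite !expect_birkhoff// expect_indic//.
  have : N%:R * (eta * pr (F M)) <= (N - M)%:R * (eta * pr (F M)) + M%:R * (eta * pr (F M)).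
    rewrite -mulrDl ler_wpM2r ?mulr_ge0 ?pr_ge0 ?(ltW eta0)// -natrD ler_nat; lia.
  rewrite !(mulrCA _ eta); lra.
- move=> n x nB; case: n => [|n]; first by rewrite birkhoff_sum0 mul0r.
  rewrite leNgt; apply/negP => /ltW h; apply: nB.
  by exists n.+1 => //; exists n.+1.
Qed.

End MeasurePreserving.

(** * Subadditive cocycles over an ergodic map *)

Section ErgodicSubadditive.
Context d (Om : measurableType d) (R : realType) (P : probability Om R).
Variable T : Om -> Om.
Hypotheses (mpT : measure_preserving P T) (ergT : ergodic P T).
Local Notation integrableR := (integrableR P).
Local Notation expect := (expect P).
Local Notation pr := (pr P).

(* The increasing union of the preimages of [D] is strictly invariant and has
   the same probability as [D]. *)
Lemma forward_invariant_01 D : measurable D -> D `<=` T @^-1` D ->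
  pr D = 0 \/ pr D = 1.
Proof.
move=> mD sub; pose F n := iter n T @^-1` D.
have mF n : measurable (F n).
  by rewrite /F -[_ @^-1` _]setTI; exact: (measurable_iter mpT).
have ndF : nondecreasing_seq F.
  by apply/nondecreasing_seqP => n; apply/subsetPset => x Dx; exact: (sub _ Dx).
have mU : measurable (\bigcup_n F n) by exact: bigcupT_measurable.
have prU : pr (\bigcup_n F n) = pr D.
  have := pr_bigcup_cvg (P := P) mF ndF.
  under eq_fun do rewrite pr_preimage_iter//.
  by move=> /(cvg_unique _ (cvg_cst (pr D))) => <-.
have inv : T @^-1` (\bigcup_n F n) = \bigcup_n F n.
  apply/seteqP; split=> [x [n _ Fn]|x [n _ Fn]].
    by exists n.+1 => //; rewrite /F /preimage /= -iterS iterSr.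
  by exists n => //; rewrite /F /preimage/= -iterSr iterS; exact: sub.
by rewrite -prU /pr; case: (ergT mU inv) => ->; [left|right].
Qed.

Variable a : nat -> Om -> R.
Hypothesis a_ge0 : forall n x, 0 <= a n x.
Hypothesis a_init : forall x, a 0 x = 0.
Hypothesis a_sub : forall m n x, a (m + n) x <= a m x + a n (iter m T x).
Hypothesis a_meas : forall n, measurable_fun setT (a n).
Hypothesis a1_int : integrableR (a 1).

Lemma subadditive_le_birkhoff n x : a n x <= birkhoff_sum T (a 1) n x.
Proof.
elim: n => [|n IH]; first by rewrite a_init birkhoff_sum0.
rewrite birkhoff_sumS -addn1; apply: le_trans (a_sub _ _ _) _.
by rewrite lerD2r.
Qed.

Lemma a_int n : integrableR (a n).
Proof.
apply: (@le_integrableR _ _ _ _ _ (birkhoff_sum T (a 1) n)) => //.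
  by move=> x; rewrite a_ge0 subadditive_le_birkhoff.
exact: integrableR_birkhoff.
Qed.

(** By Fekete's lemma this is also the limit of the averages; the infimum gives a lower bound at
    every [n] at once. The shift [n.+1] avoids dividing by zero. *)
Definition rate : R := inf (range (fun n => expect (a n.+1) / n.+1%:R)).

Lemma rate_has_inf : has_inf (range (fun n => expect (a n.+1) / n.+1%:R)).
Proof.
split; first by exists (expect (a 1) / 1); exists 0%N.
by exists 0 => _ [n _ <-]; rewrite divr_ge0// expect_ge0.
Qed.

Lemma rate_ge0 : 0 <= rate.
Proof.
apply: lb_le_inf; first by case: rate_has_inf.
by move=> _ [n _ <-]; rewrite divr_ge0// expect_ge0.
Qed.

Lemma rate_le n : n%:R * rate <= expect (a n).
Proof.
case: n => [|n]; first by rewrite mul0r expect_ge0.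
rewrite mulrC -ler_pdivlMr//; apply: ge_inf; first by case: rate_has_inf.
by exists n.
Qed.

Lemma rate_approx e : 0 < e -> exists2 n, (0 < n)%N & expect (a n) <= n%:R * (rate + e).
Proof.
move=> e0; have [_ [n _ <-] h] := inf_adherent e0 rate_has_inf.
by exists n.+1 => //; rewrite mulrC -ler_pdivrMr// ltW.
Qed.

Lemma expect_multiple n k : expect (a (k * n)) <= k%:R * expect (a n).
Proof.
elim: k => [|k IH].
  by rewrite mul0n mul0r (_ : a 0 = fun=> 0) ?expect_cst//; apply/funext.
have -> : k.+1%:R * expect (a n) = k%:R * expect (a n) + expect (a n).
  by rewrite -natr1 mulrDl mul1r.
apply: le_trans (lerD IH (lexx _)).
rewrite mulSn addnC -[X in _ <= _ + X](expect_iter mpT (k * n) (a_int n))//.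
rewrite -expectD; [|exact: a_int|exact: (integrableR_iter mpT _ (a_int n))].
apply: le_expect => //; first exact: a_int.
by apply: integrableRD; [exact: a_int|exact: (integrableR_iter mpT _ (a_int n))].
Qed.

(* The points along which [a n] eventually outgrows [rate + e]: they form a forward
   invariant set, which cannot have full measure as [rate] is an infimum. *)
Lemma drift_null e : 0 < e ->
  pr (\bigcup_C \bigcap_n [set x | n%:R * (rate + e) - C%:R <= a n x]) = 0.
Proof.
move=> e0; set F := fun C => \bigcap_n [set x | n%:R * (rate + e) - C%:R <= a n x].
have mF C : measurable (F C).
  by apply: bigcapT_measurable => n; exact: measurable_leset.
have ndF : nondecreasing_seq F.
  move=> C C' CC'; apply/subsetPset => x FC n _; apply: le_trans (FC n I).
  by rewrite lerB// ler_nat.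
have mU : measurable (\bigcup_C F C) by exact: bigcupT_measurable.
case: (forward_invariant_01 mU) => [x [C _ FC]|//|p1].
  (* Passing from [x] to [T x] lowers the cost by at most [a 1 x], which the larger constant
     absorbs. *)
  exists (C + (Num.truncn (a 1 x)).+1)%N => // n _ /=.
  have := FC n.+1 I; have /ltW := truncnS_gt (a 1 x).
  have := a_sub 1 n x; rewrite add1n natrD /= -[n.+1%:R]natr1.
  by have := rate_ge0; lra.
(* Multiples of an almost optimal [n0] stay almost optimal in expectation, whereas [a n] is at least
   [n * (rate + e) - C] on [F C]. A full-measure union would therefore force
   [rate + e <= rate + e / 2]. *)
have [n0 n00 hn0] := rate_approx (divr_gt0 e0 (@ltr0n R 2)).
have bound C : (rate + e) * pr (F C) <= rate + e / 2.
  apply/ler_addgt0Pl => t t0.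
  pose k := (Num.truncn (C%:R / t)).+1.
  have /ltW := truncnS_gt (C%:R / t); rewrite -/k ler_pdivrMr// => Ct.
  pose n := (k * n0)%N.
  have n0R : 0 < n%:R :> R by rewrite ltr0n /n muln_gt0 n00.
  have Cn : C%:R <= n%:R * t.
    by apply: le_trans Ct _; rewrite ler_wpM2r ?(ltW t0)// ler_nat leq_pmulr.
  have up : expect (a n) <= n%:R * (rate + e / 2).
    apply: le_trans (expect_multiple _ _) _.
    by rewrite /n natrM -mulrA ler_wpM2l.
  have low : (n%:R * (rate + e) - C%:R) * pr (F C) <= expect (a n).
    rewrite -(expect_indic P (mF C)) -expectZ; last exact: integrableR_indic.
    apply: le_expect; [|exact: a_int|].
      by apply: integrableRZ; exact: integrableR_indic.
    move=> x; rewrite indicE; have [/set_mem FCx|] := boolP (x \in F C).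
      by rewrite mulr1; exact: FCx.
    by rewrite mulr0.
  rewrite -(ler_pM2l n0R).
  have := pr_le1 P (mF C); have := pr_ge0 P (F C).
  have : C%:R * pr (F C) <= C%:R by rewrite ler_piMr// pr_le1.
  by move: low; rewrite mulrBl !mulrDr !mulrDl !mulrDr; lra.
have : (rate + e) * pr (\bigcup_C F C) <= rate + e / 2.
  have cv : (rate + e) * pr (F C) @[C --> \oo] --> (rate + e) * pr (\bigcup_C F C).
    by apply: cvgMr; exact: pr_bigcup_cvg.
  rewrite -(cvg_lim _ cv)//; apply: limr_le; first by apply/cvg_ex; eexists; exact: cv.
  by apply: nearW.
by rewrite p1; lra.
Qed.

(** The charge [g] is [a 1] restricted to [W N], where no stretch of length at most [N] is strictly
    cheaper than [rate + e] on average, or where [a 1] is at least [N]. By [drift_null] almost every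
    point eventually leaves [W N], so dominated convergence makes the expectation small for large
    [N]. *)
Lemma almost_additive_bound e : 0 < e -> exists (g : Om -> R) (C : R),
  [/\ forall x, 0 <= g x, integrableR g, expect g <= e, 0 <= C &
      forall n x, a n x <= n%:R * (rate + e) + birkhoff_sum T g n x + C].
Proof.
move=> e0.
pose G l := [set x | l%:R * (rate + e) <= a l x].
have mG l : measurable (G l) by exact: measurable_leset.
pose B N := \bigcap_(l in [set l | (0 < l <= N)%N]) G l.
have mB N : measurable (B N) by exact: bigcap_measurableType.
pose H N := [set x | N%:R <= a 1 x].
have mH N : measurable (H N) by exact: measurable_leset.
pose W N := B N `|` H N.
have mW N : measurable (W N) by exact: measurableU.
pose g N x := \1_(W N) x * a 1 x.
have mg N : measurable_fun setT (g N).
  by apply: measurable_funM => //; exact: measurable_indic.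
have g0 N x : 0 <= g N x by rewrite mulr_ge0.
have ga N x : g N x <= a 1 x.
  by rewrite /g indicE; case: (_ \in _); rewrite ?mul1r ?mul0r.
have gi N : integrableR (g N).
  by apply: (le_integrableR (mg N)) a1_int => x; rewrite g0 ga.
have cv0 : expect (g N) @[N --> \oo] --> (0 : R).
  have [|||||_ _] := @dominated_convergence _ _ _ P setT measurableT
    (fun N x => (g N x)%:E) (fun=> 0%E) (fun x => (a 1 x)%:E).
  - by move=> N; exact/measurable_EFinP.
  - exact: measurable_cst.
  - exists (\bigcup_C \bigcap_n [set x | n%:R * (rate + e) - C%:R <= a n x]).
    have mU : measurable (\bigcup_C \bigcap_n
        [set x | n%:R * (rate + e) - C%:R <= a n x]).
      apply: bigcupT_measurable => C; apply: bigcapT_measurable => n.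
      exact: measurable_leset.
    split => //; first by have := prE P mU; rewrite drift_null.
    move=> x /= ncv; apply: contrapT => nU; apply: ncv => _.
    have [l l0 al] : exists2 l, (0 < l)%N & a l x < l%:R * (rate + e).
      apply: contrapT => h; apply: nU; exists 0%N => // l _ /=.
      rewrite subr0 leNgt; apply/negP => al; apply: h; exists l => //.
      by case: l al => // al; move: al; rewrite a_init mul0r ltxx.
    apply: cvg_near_cst.
    exists (l + (Num.truncn (a 1 x)).+1)%N => // N /= Nbig.
    rewrite /g indicE memNset ?mul0r//; case=> [BN|].
      by have := BN l; rewrite /G /= leNgt al; move=> /(_ ltac:(lia)).
    apply/negP; rewrite -ltNge; apply: lt_le_trans (truncnS_gt _) _.
    by rewrite ler_nat; exact: leq_trans (leq_addl _ _) Nbig.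
  - exact: a1_int.
  - by apply/aeW => x N _ /=; rewrite lee_fin ger0_norm.
  - by rewrite integral0 => /fine_cvgP[_].
have [N _ /(_ N (leqnn N)) gN] : \forall N \near \oo, expect (g N) < e.
  exact: (cvgr_lt 0 cv0).
exists (g N), (N%:R * N%:R); split; [exact: g0|exact: gi|exact: ltW|exact: mulr_ge0|].
apply: (subadditive_cover a_init a_sub (B := W N)) => //.
- by rewrite addr_ge0 ?rate_ge0 ?ltW.
- move=> x nW; apply: contrapT => h; apply: nW; left => l /= /andP[l0 lN].
  by rewrite /G /= leNgt; apply/negP => al; apply: h; exists l; split => //; exact: ltW.
- by move=> x Wx; rewrite /g indicE mem_set// mul1r.
- move=> x; have [Wx|nW] := pselect (W N x).
    by rewrite /g indicE mem_set// mul1r lerDr.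
  rewrite -[leLHS]addr0 lerD// ltW// ltNge; apply/negP => h; apply: nW.
  by right.
Qed.

(** In the bound of [almost_additive_bound] the maximal inequality controls the Birkhoff sum of [g]
    for all times, off a set of small probability. *)
Lemma limsup_le_rate : P.-negligible
  [set x | ~ forall e, 0 < e -> \forall n \near \oo, a n x <= n%:R * (rate + e)].
Proof.
pose F k := [set x | ~ \forall n \near \oo, a n x <= n%:R * (rate + k.+1%:R^-1)].
apply: (@negligibleS _ _ _ P (\bigcup_k F k)).
  move=> x /= nx; apply: contrapT => nU; apply: nx => e e0.
  have [k] := ltr_add_invr e0; rewrite add0r => ke.
  have : \forall n \near \oo, a n x <= n%:R * (rate + k.+1%:R^-1).
    by apply: contrapT => h; apply: nU; exists k.
  apply: filterS => n /le_trans; apply.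
  by rewrite ler_wpM2l// lerD2l ltW.
apply: negligible_bigcup => k; rewrite /F.
have : 0 < k.+1%:R^-1 :> R by rewrite invr_gt0.
move: (k.+1%:R^-1) => e e0.
apply: negligible_small => t t0.
(* The first bound controls the linear error; the second makes the exceptional probability
   [expect g / (e / 3)] at most [t]. *)
pose eps := Num.min (e / 3) (t * (e / 3)).
have e3 : 0 < e / 3 by rewrite divr_gt0.
have eps0 : 0 < eps by rewrite lt_min e3 mulr_gt0.
have [g [C [g0 gi ge C0 ub]]] := almost_additive_bound eps0.
have [B [mB prB hB]] := maximal_inequality mpT gi g0 e3.
exists B; split => //; last first.
  apply: le_trans prB _; rewrite ler_pdivrMr//.
  by apply: le_trans ge _; rewrite ge_min lexx orbT.
move=> x /= nev; apply: contrapT => nBx; apply: nev.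
exists (Num.truncn (C / (e / 3))).+1 => // n /= nbig.
apply: le_trans (ub n x) _.
have : C <= n%:R * (e / 3).
  rewrite -ler_pdivrMr//; apply: le_trans (ltW (truncnS_gt _)) _.
  by rewrite ler_nat.
have := hB n x nBx.
have : n%:R * eps <= n%:R * (e / 3) by rewrite ler_wpM2l// ge_min lexx.
by rewrite !mulrDr; lra.
Qed.

Lemma measurable_slow_drop b L n : measurable (slow_drop T a b L n).
Proof.
have -> : slow_drop T a b L n = \bigcup_(l in [set l | (L <= l <= n)%N])
    [set x | a n x - a (n - l) (iter l T x) <= l%:R * b].
  apply/seteqP; split=> x.
    by move=> [l [Ll ln h]]; exists l => //=; rewrite Ll.
  by move=> [l /= /andP[Ll ln] h]; exists l.
apply: bigcup_measurable => l _; apply: measurable_leset => //.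
apply: measurable_funB => //.
by apply: measurableT_comp => //; exact: (measurable_iter mpT).
Qed.

(** Integrate [slow_drop_count] and use [rate_le] from below. Invariance turns the expected number
    of bad times into the sum of probabilities over horizons [n = N - m]. *)
Lemma slow_drop_rare e delta L0 : 0 < e -> 0 < delta -> exists2 L, (L0 <= L)%N &
  forall N, \sum_(1 <= n < N.+1) pr (slow_drop T a (rate - e) L n) <= delta * N%:R.
Proof.
(* A third of the budget goes to each error: the excess of the crossing rate over [rate], the
   expectation of [g], and [C]. *)
move=> e0 delta0; pose e1 := delta * e / 3.
have e10 : 0 < e1 by rewrite divr_gt0// mulr_gt0.
have [g [C [g0 gi ge C0 ub]]] := almost_additive_bound e10.
pose L := (L0 + (Num.truncn (C / e1)).+1)%N.
have CL : C <= L%:R * e1.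
  rewrite -ler_pdivrMr//; apply: le_trans (ltW (truncnS_gt _)) _.
  by rewrite ler_nat leq_addl.
have L0' : (0 < L)%N by rewrite /L addnS.
exists L => [|N]; first exact: leq_addr.
(* Horizons shorter than [L] contain no window of length [L]; otherwise [C <= L * e1 <= N * e1]. *)
have [NL|LN] := ltnP N L.
  rewrite big_nat big1 ?mulr_ge0 ?(ltW delta0)// => n /andP[_ nN].
  rewrite (_ : slow_drop _ _ _ _ _ = set0) ?/pr ?measure0//.
  by rewrite -subset0 => x [l [? ? _]]; lia.
pose S x : R := \sum_(0 <= m < N) \1_(slow_drop T a (rate - e) L (N - m)) (iter m T x).
have Si : integrableR S.
  apply: integrableR_sum => m; apply: (integrableR_iter mpT) => //.
  by apply: integrableR_indic; exact: measurable_slow_drop.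
have ES : expect S = \sum_(1 <= n < N.+1) pr (slow_drop T a (rate - e) L n).
  rewrite expect_sum; last first.
    move=> m; apply: (integrableR_iter mpT) => //.
    by apply: integrableR_indic; exact: measurable_slow_drop.
  rewrite [RHS]big_nat_rev big_add1 /=; apply: eq_bigr => m _.
  rewrite (expect_iter mpT)//; last first.
    by apply: integrableR_indic; exact: measurable_slow_drop.
  rewrite expect_indic; last exact: measurable_slow_drop.
  by congr (pr (slow_drop _ _ _ _ _)); lia.
have : expect (a N) + e * expect S <= N%:R * (rate + e1) + N%:R * expect g + C.
  have bi : integrableR (birkhoff_sum T g N) by exact: (integrableR_birkhoff mpT).
  have li : integrableR (fun x => a N x + e * S x).
    by apply: integrableRD; [exact: a_int|exact: integrableRZ].
  have cbi : integrableR (fun x => N%:R * (rate + e1) + birkhoff_sum T g N x).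
    by apply: integrableRD => //; exact: integrableR_cst.
  have ri : integrableR (fun x => N%:R * (rate + e1) + birkhoff_sum T g N x + C).
    by apply: integrableRD => //; exact: integrableR_cst.
  have <- : expect (fun x => a N x + e * S x) = expect (a N) + e * expect S.
    by rewrite expectD; [rewrite expectZ|exact: a_int|exact: integrableRZ].
  have <- : expect (fun x => N%:R * (rate + e1) + birkhoff_sum T g N x + C) =
      N%:R * (rate + e1) + N%:R * expect g + C.
    rewrite expectD//; last exact: integrableR_cst.
    rewrite expectD//; last exact: integrableR_cst.
    by rewrite !expect_cst (expect_birkhoff mpT).
  apply: le_expect => //.
  move=> x.
  have := @slow_drop_count _ _ _ _ a_init a_sub (rate - e) _ C L g N x C0 g0 ub e.
  by apply; [exact: ltW|by []|have -> : rate + e1 - (rate - e) - e = e1 by lra].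
rewrite ES => main.
have := rate_le N.
have : C <= N%:R * e1.
  by apply: le_trans CL _; rewrite ler_wpM2r ?ler_nat// ltW.
have : N%:R * expect g <= N%:R * e1 by rewrite ler_wpM2l.
have : N%:R * e1 = e * (delta * N%:R) / 3 by rewrite /e1; field.
move=> h1 h2 h3 h4; rewrite -(ler_pM2l e0).
by move: main; rewrite mulrDr; lra.
Qed.

(* The one-sided form of the Gouezel-Karlsson theorem. *)
Lemma good_times : P.-negligible [set x | ~ exists Ls : nat -> nat,
  forall k, exists2 n, (k <= n)%N & forall i l, (Ls i <= l)%N -> (l <= n)%N ->
    l%:R * (rate - i.+1%:R^-1) <= a n x - a (n - l) (iter l T x)].
Proof.
apply: negligible_small => t t0.
have /choice[Ls hLs] : forall i, exists L, (i <= L)%N /\ forall N,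
    \sum_(1 <= n < N.+1) pr (slow_drop T a (rate - i.+1%:R^-1) L n)
      <= t / 2 ^+ i.+2 * N%:R.
  move=> i; have [||L iL hL] := @slow_drop_rare (i.+1%:R^-1) (t / 2 ^+ i.+2) i.
  - by rewrite invr_gt0.
  - by rewrite divr_gt0// exprn_gt0.
  - by exists L.
pose S i n := slow_drop T a (rate - i.+1%:R^-1) (Ls i) n.
have mS i n : measurable (S i n) by exact: measurable_slow_drop.
(* Finitely many [i] suffice: for [i > n] no [l] satisfies [Ls i <= l <= n], because [i <= Ls i]. *)
pose Bad n := \big[setU/set0]_(i < n.+1) S i n.
have mBad n : measurable (Bad n) by exact: bigsetU_measurable.
have geom m : \sum_(i < m) t / 2 ^+ i.+2 = t / 2 - t / 2 ^+ m.+1.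
  elim: m => [|m IH]; first by rewrite big_ord0 expr1 subrr.
  rewrite big_ord_recr/= IH [2 ^+ m.+2]exprS; field.
  by rewrite expf_neq0.
have sumBad N : \sum_(1 <= n < N.+1) pr (Bad n) <= t / 2 * N%:R.
  apply: (@le_trans _ _ (\sum_(1 <= n < N.+1) \sum_(i < N.+1) pr (S i n))).
    apply: ler_sum_nat => n /andP[_ nN].
    apply: le_trans (pr_bigsetU P n.+1 (fun i => mS i n)) _.
    rewrite -(big_mkord xpredT (fun i => pr (S i n))).
    rewrite -(big_mkord xpredT (fun i => pr (S i n))).
    rewrite [leRHS](@big_cat_nat _ _ _ n.+1)//= lerDl.
    by apply: sumr_ge0 => i _; exact: pr_ge0.
  rewrite exchange_big/=.
  apply: (@le_trans _ _ (\sum_(i < N.+1) t / 2 ^+ i.+2 * N%:R)).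
    by apply: ler_sum => i _; have [_] := hLs i; exact.
  rewrite -mulr_suml ler_wpM2r// geom lerBlDr lerDl.
  by rewrite divr_ge0 ?(ltW t0)// exprn_ge0.
pose F k := \bigcap_(n in [set n | (k < n)%N]) Bad n.
have mF k : measurable (F k) by exact: bigcap_measurableType.
have ndF : nondecreasing_seq F.
  move=> k k' kk'; apply/subsetPset => x Fx n /= kn; apply: Fx => /=.
  exact: leq_ltn_trans kn.
have Ft k : pr (F k) <= t.
  (* [F k] lies in [Bad n] for every [n] from [K] to [2 * K], so the average bound [t / 2] over
     [2 * K] horizons gives [t]. *)
  pose K := k.+1.
  have : K%:R * pr (F k) <= t / 2 * (2 * K)%N%:R.
    apply: le_trans (sumBad (2 * K)%N).
    rewrite (@big_cat_nat _ _ _ K)/=; [|by []|lia].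
    rewrite -[leLHS]add0r; apply: lerD; first by apply: sumr_ge0 => i _; exact: pr_ge0.
    apply: (@le_trans _ _ (\sum_(K <= n < (2 * K).+1) pr (F k))).
      rewrite big_const_nat iter_addr_0 -[leRHS]mulr_natl ler_wpM2r ?pr_ge0// ler_nat; lia.
    apply: ler_sum_nat => n /andP[Kn _].
    by apply: le_pr => // x; apply.
  rewrite natrM mulrA divfK// mulrC ler_pM2r// ltr0n//.
exists (\bigcup_k F k); split; first exact: bigcupT_measurable.
  move=> x /= nx; apply: contrapT => nU; apply: nx; exists Ls => k.
  have [n kn nB] : exists2 n, (k < n)%N & ~ Bad n x.
    apply: contrapT => h; apply: nU; exists k => // n /= kn.
    by apply: contrapT => nB; apply: h; exists n.
  exists n; first exact: ltnW.
  move=> i l Ll ln; rewrite leNgt; apply/negP => /ltW h; apply: nB.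
  rewrite /Bad -(bigcup_mkord n.+1 (S^~ n)); exists i => /=.
    by have [iL _] := hLs i; lia.
  by exists l.
have cv := pr_bigcup_cvg (P := P) mF ndF.
rewrite -(cvg_lim _ cv)//; apply: limr_le; first by apply/cvg_ex; eexists; exact: cv.
by apply: nearW.
Qed.

End ErgodicSubadditive.

(** * The topology of pointwise convergence *)

Section PointwiseConvergence.
Variable R : realType.

(* The library states the product topology results for index types with decidable
   equality; they are transported to [Z] through its classical [eqType]. *)
Let eval_continuous_eqType (Z : eqType) (x : Z) :
  continuous (fun f : {ptws Z -> R} => f x).
Proof. exact: (@proj_continuous Z (fun=> (R : topologicalType)) x). Qed.

Lemma ptws_eval_continuous (Z : Type) (x : Z) :
  continuous (fun f : {ptws Z -> R} => f x).
Proof.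
exact (@eval_continuous_eqType (boolp_classicType__canonical__eqtype_Equality Z) x).
Qed.

Let box_compact_eqType (Z : eqType) (r : Z -> R) :
  compact [set f : {ptws Z -> R} | forall y, [set` `[- r y, r y]] (f y)].
Proof.
exact: (@tychonoff Z (fun=> (R : topologicalType))
  (fun y => [set` `[- r y, r y]]) (fun y => @segment_compact R (- r y) (r y))).
Qed.

Lemma ptws_box_compact (Z : Type) (r : Z -> R) :
  compact [set f : {ptws Z -> R} | forall y, [set` `[- r y, r y]] (f y)].
Proof.
exact (@box_compact_eqType (boolp_classicType__canonical__eqtype_Equality Z) r).
Qed.

Lemma ptws_nbhs_gt (Z : Type) (h : {ptws Z -> R}) x (c : R) : c < h x ->
  nbhs h [set f : {ptws Z -> R} | c < f x].
Proof. by move=> ch; exact: (@ptws_eval_continuous Z x h _ (lt_nbhsr ch)). Qed.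

Lemma ptws_nbhs_lt (Z : Type) (h : {ptws Z -> R}) x (c : R) : h x < c ->
  nbhs h [set f : {ptws Z -> R} | f x < c].
Proof. by move=> ch; exact: (@ptws_eval_continuous Z x h _ (lt_nbhsl ch)). Qed.

End PointwiseConvergence.

(** * Properties and existence of metric functionals *)

Section MetricFunctionals.
Context (R : realType) (Z : Type) (d : Z -> Z -> R) (z0 : Z).
Hypothesis dP : is_pseudodist d.

Lemma pseudodist_ge0 x y : 0 <= d x y.
Proof.
have [d0 [dC dT]] := dP.
by have := dT x y x; rewrite d0 (dC y x); lra.
Qed.

(** The triangle inequality gives this for horofunctions; only two coordinates are involved, so it
    passes to the closure. *)
Lemma metric_functional_le h x y : metric_functional d z0 h -> h x - h y <= d x y.
Proof.
have [_ [dC dT]] := dP => hm; rewrite leNgt; apply/negP => lt_d.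
pose e := (h x - h y - d x y) / 2.
have e0 : 0 < e by rewrite divr_gt0// subr_gt0.
have hx : nbhs (h : {ptws Z -> R}) [set f : {ptws Z -> R} | h x - e < f x].
  by apply: ptws_nbhs_gt; lra.
have hy : nbhs (h : {ptws Z -> R}) [set f : {ptws Z -> R} | f y < h y + e].
  by apply: ptws_nbhs_lt; lra.
have [_ [[z _ <-] [/= zx zy]]] := hm _ (filterI hx hy).
have := dT x y z; move: zx zy; rewrite /horofun /e; lra.
Qed.

Lemma metric_functional_base h : metric_functional d z0 h -> h z0 = 0.
Proof.
move=> hm; apply/eqP; rewrite eq_le !leNgt; apply/andP; split; apply/negP => h0.
  have [_ [[z _ <-]]] := hm _ (ptws_nbhs_gt (h := h) h0).
  by rewrite /= /horofun subrr ltxx.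
have [_ [[z _ <-]]] := hm _ (ptws_nbhs_lt (h := h) h0).
by rewrite /= /horofun subrr ltxx.
Qed.

(** Horofunctions lie in a compact box, hence cluster along the filter of large good times. A filter
    replaces a subsequence since the box need not be sequentially compact for uncountable [Z]. *)
Lemma exists_metric_functional (x : nat -> Z) (good : set nat) :
  (forall k, exists2 n, (k <= n)%N & good n) ->
  exists h, metric_functional d z0 h /\
    forall y c, (\forall n \near \oo, good n -> d y (x n) - d z0 (x n) <= c) -> h y <= c.
Proof.
move=> cof; have [_ [dC dT]] := dP.
have PF : ProperFilter (within good \oo).
  split; last exact: within_filter.
  case=> N _ hN; have [n Nn gn] := cof N.
  exact: hN n Nn gn.
pose F := (fun n => horofun d z0 (x n)) @ within good \oo.
have [|h [_ hF]] := @ptws_box_compact R Z (d z0) F _.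
  apply: nearW => n _ y; change (horofun d z0 (x n) y \in `[- d z0 y, d z0 y]).
  rewrite in_itv /= /horofun.
  by have := dT y z0 (x n); have := dT z0 y (x n); rewrite (dC y z0); lra.
exists h; split.
  by move=> B hB; apply: hF => //; apply: nearW => n; exists (x n).
move=> y c yc; rewrite leNgt; apply/negP => ch.
have FA : F [set f : {ptws Z -> R} | f y <= c] by [].
have [f [/= fc cf]] := hF _ _ FA (ptws_nbhs_gt ch).
by move: cf; rewrite ltNge fc.
Qed.

End MetricFunctionals.

(** The bounded error [C] is what a change of base point from [z0] to [z] costs. *)
Lemma cvg_linear_rate (R : realType) (f g : nat -> R) (A C : R) :
  (forall e, 0 < e -> \forall n \near \oo, n%:R * (A - e) <= g n <= n%:R * (A + e)) ->
  (forall n, `|f n - g n| <= C) ->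
  f n / n%:R @[n --> \oo] --> A.
Proof.
move=> gA fg; apply/cvgrPdist_le => e e0.
have e2 : 0 < e / 2 by rewrite divr_gt0.
near=> n.
have n0 : 0 < n%:R :> R by rewrite ltr0n; near: n; exact: nbhs_infty_gt.
have /andP[g1 g2] : n%:R * (A - e / 2) <= g n <= n%:R * (A + e / 2).
  by near: n; exact: gA.
have Cn : C <= n%:R * (e / 2).
  rewrite -ler_pdivrMr//; near: n; exact: nbhs_infty_ger.
have := fg n; rewrite ler_norml => /andP[f1 f2].
have -> : A - f n / n%:R = (n%:R * A - f n) / n%:R.
  by rewrite mulrBl mulrAC divff ?mul1r// gt_eqF.
rewrite normrM [`|_^-1|]gtr0_norm ?invr_gt0// ler_pdivrMr// ler_norml.
by move: g1 g2; rewrite mulrBr mulrDr; lra.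
Unshelve. all: by end_near.
Qed.

(** * Algebra of the cocycle and the main result *)

Section Cocycle.
Context (Om Z : Type) (T : Om -> Om) (phi : Om -> Z -> Z).

Lemma cocycleD m n w z :
  cocycle T phi (m + n) w z = cocycle T phi m w (cocycle T phi n (iter m T w) z).
Proof.
elim: n z => [|n IH] z; first by rewrite addn0.
by rewrite addnS /= IH -iterD addnC.
Qed.

Lemma cocycle_lipschitz (R : realType) (d : Z -> Z -> R) n w :
  (forall w', one_lipschitz d (phi w')) -> one_lipschitz d (cocycle T phi n w).
Proof.
move=> lip; elim: n => [//|n IH] x y /=.
by apply: le_trans (IH _ _) _; exact: lip.
Qed.

End Cocycle.

Unset Implicit Arguments.
Set Strict Implicit.

(** Holomorphic self-maps with the Kobayashi pseudo-distance are an instance of 1-Lipschitz maps of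
    a pseudo-metric space. Measurability of the orbit maps is expressed through distances to
    points. *)
Theorem theorem5p1 (R : realType) (Z : Type) (dZ : Z -> Z -> R)
  (dO : measure_display) (Om : measurableType dO) (P : probability Om R)
  (T : Om -> Om) (phi : Om -> Z -> Z) (z0 : Z) :
  is_pseudodist dZ ->
  (forall w, one_lipschitz dZ (phi w)) ->
  measure_preserving P T ->
  ergodic P T ->
  (forall (n : nat) (z z' : Z),
     measurable_fun setT (fun w => dZ z' (cocycle T phi n w z))) ->
  (exists z : Z, (\int[P]_w (dZ z (phi w z))%:E < +oo)%E) ->
  exists tau : R,
    {ae P, forall w,
      (forall z : Z,
         (fun n : nat => dZ (cocycle T phi n w z) z / n%:R) @ \oo --> tau) /\
      exists h : Z -> R, metric_functional dZ z0 h /\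
        forall z : Z,
          (fun n : nat => - h (cocycle T phi n w z) / n%:R) @ \oo --> tau}.
Proof.
move=> dP lip mpT ergT umeas [z1 z1int].
have [d0 [dC dT]] := dP.
pose u := cocycle T phi; pose a n w := dZ z0 (u n w z0).
have ulip n w : one_lipschitz dZ (u n w) by exact: cocycle_lipschitz.
have a_ge0 n w : 0 <= a n w by exact: pseudodist_ge0.
have a_init w : a 0%N w = 0 by exact: d0.
have shift l m w z : dZ (u l w z0) (u (l + m)%N w z) <= dZ z0 (u m (iter l T w) z).
  by rewrite /u cocycleD; exact: ulip.
have a_sub m n w : a (m + n)%N w <= a m w + a n (iter m T w).
  by rewrite (le_trans (dT _ (u m w z0) _))// lerD2l.
have a_meas n : measurable_fun setT (a n) by exact: umeas.
have dphi : integrableR P (fun w => dZ z1 (phi w z1)).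
  apply/integrableP; split; first exact/measurable_EFinP/(umeas 1%N).
  by under eq_integral do rewrite /= ger0_norm ?pseudodist_ge0//.
have a1_int : integrableR P (a 1%N).
  apply: (@le_integrableR _ _ _ _ _ (fun w => dZ z1 (phi w z1) + 2 * dZ z0 z1)) => //.
    move=> w; rewrite a_ge0 /a /u /=.
    have := dT z0 z1 (phi w z0); have := dT z1 (phi w z1) (phi w z0).
    by have := lip w z1 z0; rewrite (dC z1 z0); lra.
  by apply: integrableRD => //; exact: integrableR_cst.
exists (rate P a).
have sup := limsup_le_rate mpT ergT a_ge0 a_init a_sub a_meas a1_int.
have rec := good_times mpT ergT a_ge0 a_init a_sub a_meas a1_int.
apply: negligibleS (negligibleU sup rec) => w /= nw.
apply: contrapT => /not_orP[/contrapT up /contrapT [Ls good]]; apply: nw.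
set A := rate P a in up good *.
have asym e : 0 < e -> \forall n \near \oo, n%:R * (A - e) <= a n w <= n%:R * (A + e).
  move=> e0; have [i] := ltr_add_invr e0; rewrite add0r => /ltW ie.
  near=> l; apply/andP; split; last by near: l; exact: up.
  (* The lower bound uses a good time [n >= l]: by subadditivity the drop from [a n w] is at most
     [a l w]. *)
  have [n ln /(_ i l) h] := good l.
  have : l%:R * (A - i.+1%:R^-1) <= a n w - a (n - l)%N (iter l T w).
    by apply: h => //; near: l; exact: nbhs_infty_ge.
  have := a_sub l (n - l)%N w; rewrite subnKC//.
  have : l%:R * (A - e) <= l%:R * (A - i.+1%:R^-1) by rewrite ler_wpM2l// lerB.
  by move=> h1 h2 h3; rewrite (le_trans h1)// (le_trans h3)// lerBlDr.
split=> [z|].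
  apply: (cvg_linear_rate (C := 2 * dZ z z0) asym) => n.
  have := ulip n w z z0; have := dT (u n w z) (u n w z0) z; have := dT (u n w z0) z0 z.
  have := dT z0 z (u n w z0); have := dT z (u n w z) (u n w z0).
  rewrite /a (dC (u n w z0) z0) (dC z0 z) (dC z (u n w z)) ler_norml; lra.
pose good_at := [set n | forall i l, (Ls i <= l)%N -> (l <= n)%N ->
  l%:R * (A - i.+1%:R^-1) <= a n w - a (n - l)%N (iter l T w)].
have [h [hm hle]] := @exists_metric_functional R Z dZ z0 dP (fun n => u n w z0) good_at good.
exists h; split => // z.
apply: (cvg_linear_rate (g := fun n => - h (u n w z0)) (C := dZ z z0)); last first.
  move=> n; have := ulip n w z z0.
  have := metric_functional_le dP (u n w z) (u n w z0) hm.
  have := metric_functional_le dP (u n w z0) (u n w z) hm.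
  rewrite (dC (u n w z0)) ler_norml; lra.
move=> e e0; have [i] := ltr_add_invr e0; rewrite add0r => /ltW ie.
near=> l; apply/andP; split.
  (* At a good time [n >= l], [shift] bounds the horofunction of [u n w z0] at [u l w z0] by minus
     the drop. The bound is uniform in [n], so it passes to [h]. *)
  have : h (u l w z0) <= - (l%:R * (A - i.+1%:R^-1)).
    apply: hle; exists l => // n /= ln gn.
    have := gn i l; have := shift l (n - l)%N w z0; rewrite subnKC// -/(a _ _).
    have iL : (Ls i <= l)%N by near: l; exact: nbhs_infty_ge.
    by move=> h1 /(_ iL ln) h2; rewrite lerNr (le_trans h2)// opprB lerD2l lerN2.
  have : l%:R * (A - e) <= l%:R * (A - i.+1%:R^-1) by rewrite ler_wpM2l// lerB.
  by move=> h1 h2; rewrite (le_trans h1)// lerNr.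
have /andP[_] : l%:R * (A - e) <= a l w <= l%:R * (A + e) by near: l; exact: asym.
apply: le_trans.
have := metric_functional_le dP z0 (u l w z0) hm.
by rewrite (metric_functional_base hm) sub0r.
Unshelve. all: by end_near.
Qed.
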